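(* Let $G$ be a finite simple graph with $n$ vertices. Then $\mathrm{HG_{lin}}(G)\le n-\mathrm{mr}(G)+1$; that is, every prime power $q$ for which $G$ is linearly $q$-solvable satisfies $q\le n-\mathrm{mr}(G)+1$.
   Context: Let $G$ have vertices $v_1,\ldots,v_n$. An $n\times n$ matrix $M$ over a finite field $\mathbb{F}_q$ fits $G$ if $M_{i,i}\ne0$ for $1\le i\le n$ and $M_{i,j}=M_{j,i}=0$ whenever $i\neq j$ and $v_i,v_j$ are not adjacent in $G$. The minimum rank $\mathrm{mr}(G)$ is the minimum integer $r$ for which there exists a matrix $M$ over some finite field which fits $G$ and has $\mathrm{rank}(M)=r$. Let $q$ be a prime power, and let the set of colors be the finite field $\mathbb{F}_q$. A coloring is any $x\in\mathbb{F}_q^n$, where $x_i$ is the color of $v_i$. A linear guessing strategy over $\mathbb{F}_q$ is a choice, for each $i$, of an affine function $f_i(x)=\sum_{j\in N_i}a_{i,j}x_j+b_i$ with $a_{i,j},b_i\in\mathbb{F}_q$, where $N_i$ is the set of indices of the neighbors of $v_i$; vertex $v_i$ guesses correctly on $x$ if $f_i(x)=x_i$. $G$ is linearly $q$-solvable if there is a linear guessing strategy over $\mathbb{F}_q$ such that for every $x\in\mathbb{F}_q^n$ at least one vertex guesses correctly. The linear hat guessing number $\mathrm{HG_{lin}}(G)$ is the largest prime power $q$ for which $G$ is linearly $q$-solvable. *)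

(* Defs.v *)
From HB Require Import structures.
From mathcomp Require Import all_boot all_order all_algebra.
From mathcomp Require Import boolp.

Set Implicit Arguments.
Unset Strict Implicit.
Unset Printing Implicit Defensive.

Import GRing.Theory.
Local Open Scope ring_scope.

(* A finite simple graph on n vertices is its adjacency relation on 'I_n. *)
Definition simple_graph (n : nat) (e : rel 'I_n) : Prop :=
  symmetric e /\ irreflexive e.

(* M is not required to be symmetric; only its zero pattern is constrained. *)
Definition fits (n : nat) (e : rel 'I_n) (F : finFieldType) (M : 'M[F]_n)
    : Prop :=
  (forall i, M i i != 0) /\
  (forall i j, i != j -> ~~ e i j -> M i j = 0 /\ M j i = 0).

Definition fit_rank (n : nat) (e : rel 'I_n) (r : nat) : Prop :=
  exists (F : finFieldType) (M : 'M[F]_n), fits e M /\ \rank M = r.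

Lemma fit_rank_order (n : nat) (e : rel 'I_n) : fit_rank e n.
Proof.
exists 'F_2, 1%:M; split; last by rewrite mxrank1.
split=> [i | i j ij _]; first by rewrite mxE eqxx oner_neq0.
by rewrite !mxE [j == i]eq_sym (negbTE ij).
Qed.

Lemma ex_fit_rank (n : nat) (e : rel 'I_n) : exists r, `[< fit_rank e r >].
Proof. by exists n; apply/asboolP; apply: fit_rank_order. Qed.

Definition mr (n : nat) (e : rel 'I_n) : nat := ex_minn (ex_fit_rank e).

(* In particular the natural-number difference n - mr e is never truncated. *)
Lemma mr_leq (n : nat) (e : rel 'I_n) : (mr e <= n)%N.
Proof.
rewrite /mr; case: ex_minnP => r _; apply.
by apply/asboolP; apply: fit_rank_order.
Qed.

Definition guess (n : nat) (e : rel 'I_n) (F : finFieldType)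
    (a : 'M[F]_n) (b x : 'rV[F]_n) (i : 'I_n) : F :=
  \sum_(j | e i j) a i j * x 0 j + b 0 i.

(* The field with q elements is unique up to isomorphism, so it does not matter
   which one is used. *)
Definition lin_solvable (n : nat) (e : rel 'I_n) (q : nat) : Prop :=
  exists F : finFieldType, #|F| = q /\
    exists (a : 'M[F]_n) (b : 'rV[F]_n),
      forall x : 'rV[F]_n, exists i : 'I_n, guess e a b x i = x 0 i.

Definition prime_power (q : nat) : Prop :=
  exists p k : nat, [/\ prime p, (0 < k)%N & q = (p ^ k)%N].

(* A relation rather than a function: for some graphs, such as edgeless ones,
   no prime power is linearly solvable and the maximum does not exist. *)
Definition is_HG_lin (n : nat) (e : rel 'I_n) (h : nat) : Prop :=
  [/\ prime_power h, lin_solvable e h &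
      forall q, prime_power q -> lin_solvable e q -> (q <= h)%N].

(* Main.v *)
Require Import Defs.
From mathcomp Require Import all_boot.
From mathcomp Require Import all_algebra boolp.

(** A vertex guesses correctly on [x] exactly when [x] lies on a certain affine
hyperplane, and the matrix [M] whose rows are the normals of these hyperplanes
(the strategy coefficients, with [-1] on the diagonal) fits the graph.  A
winning strategy is thus a covering of [F^n] by [n] hyperplanes, and it is
enough to bound [q = #|F|] by [n - \rank M + 1], since [\rank M] is at least
the minimum rank of the graph.

Put [r = \rank M] and choose [r] independent rows of [M].  The values of the
corresponding affine forms may be prescribed arbitrarily, so they can serve as
coordinates [y] of [F^r].  The points whose coordinates are all nonzero avoid
the [r] chosen hyperplanes, hence these [(q - 1)^r] points are covered by the
other [n - r].  In the new coordinates each of the latter is still given by a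
nonconstant affine form; solving for one coordinate shows that it contains at
most a fraction [1 / (q - 1)] of these points ([card_hyperplane_grid]).
Therefore [n - r >= q - 1] ([leq_card_grid_cover], [leq_card_cover]). *)

Set Implicit Arguments.
Unset Strict Implicit.
Unset Printing Implicit Defensive.

Import GRing.Theory.
Local Open Scope ring_scope.

Definition nowhere_zero (F : finFieldType) (r : nat) : {set 'cV[F]_r} :=
  [set y : 'cV[F]_r | [forall k, y k 0 != 0]].

Definition hyperplane (F : finFieldType) (r : nat) (w : 'rV[F]_r) (c : F) :
    {set 'cV[F]_r} :=
  [set y : 'cV[F]_r | (w *m y) 0 0 + c == 0].

Definition set_coord (F : finFieldType) (r : nat) (k : 'I_r) (t : F)
    (y : 'cV[F]_r) : 'cV[F]_r :=
  \col_j (if j == k then t else y j 0).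

(** If [w 0 k != 0], a point of the hyperplane is determined by its coordinates
other than the [k]th, so overwriting that coordinate with the [#|F|.-1] nonzero
scalars produces pairwise distinct nowhere-zero points. *)
Lemma card_hyperplane_grid (F : finFieldType) (r : nat) (w : 'rV[F]_r) (c : F) :
  w != 0 ->
  (#|F|.-1 * #|nowhere_zero F r :&: hyperplane w c| <= #|nowhere_zero F r|)%N.
Proof.
move=> /rV0Pn[k wk0].
rewrite -(cardsC1 (0 : F)) -cardsX.
set D := setX _ _.
pose g (p : F * 'cV[F]_r) := set_coord k p.1 p.2.
have g_inj : {in D &, injective g}.
  move=> [t y] [t' y']; rewrite !inE /=.
  move=> /and3P[_ _ /eqP Hy] /and3P[_ _ /eqP Hy'] /colP eqg.
  have ->: t = t' by have := eqg k; rewrite !mxE eqxx.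
  have eqj j : j != k -> y j 0 = y' j 0.
    by move=> /negbTE jk; have := eqg j; rewrite !mxE jk.
  congr (_, _); apply/colP => j; have [->|/eqj//] := eqVneq j k.
  apply: (mulfI wk0); move: Hy; rewrite -Hy' => /addIr.
  rewrite !mxE (bigD1 k) //= [RHS](bigD1 k) //=.
  under eq_bigr => i ik do rewrite eqj //.
  by move/addIr.
rewrite -(card_in_imset g_inj); apply/subset_leq_card/subsetP => z.
case/imsetP => -[t y]; rewrite !inE /= => /and3P[t0 /forallP y0 _] ->.
by apply/forallP => j; rewrite mxE; case: ifP.
Qed.

Lemma leq_card_grid_cover (F : finFieldType) (r : nat) (I : finType)
    (A : {set I}) (w : I -> 'rV[F]_r) (c : I -> F) :
  {in A, forall i, w i != 0} ->
  nowhere_zero F r \subset \bigcup_(i in A) hyperplane (w i) (c i) ->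
  (#|F|.-1 <= #|A|)%N.
Proof.
move=> w0 cover.
have N0 : (0 < #|nowhere_zero F r|)%N.
  apply/card_gt0P; exists (const_mx 1).
  by rewrite inE; apply/forallP => k; rewrite mxE oner_neq0.
rewrite -(leq_pmul2r N0).
have cardN : (#|nowhere_zero F r| <=
    \sum_(i in A) #|nowhere_zero F r :&: hyperplane (w i) (c i)|)%N.
  rewrite -{1}(setIidPl cover) big_distrr /=.
  elim/big_rec2: _ => [|i m B _ le_m]; first by rewrite cards0.
  by rewrite (leq_trans (leq_card_setU _ _)) // leq_add2l.
rewrite (leq_trans (leq_mul (leqnn _) cardN)) // big_distrr /= -sum_nat_const.
by apply: leq_sum => i /w0; apply: card_hyperplane_grid.
Qed.

(** A maximal independent set of rows of [M], together with a right inverse [P]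
of the submatrix [B] they form, gives the change of coordinates
[x = P *m (y - b')], with [b'] the matching entries of [b], under which the
chosen forms become the coordinates of [y].  Every other row [row i M] lies in
the row space of [B], so it can be recovered from its new normal
[row i M *m P], which is therefore nonzero. *)
Lemma leq_card_cover (F : finFieldType) (m n : nat) (M : 'M[F]_(m, n))
    (b : 'cV[F]_m) :
  (forall i, row i M != 0) ->
  (forall x : 'cV[F]_n, exists i, (M *m x + b) i 0 = 0) ->
  (#|F| <= m - \rank M + 1)%N.
Proof.
move=> M0 cover.
pose f := maxrankfun M; pose B := rowsub f M; pose P := pinvmx B.
have BP : B *m P = 1%:M by apply: mulmxVp; apply: maxrowsub_free.
pose x y := P *m (y - rowsub f b).
pose A := ~: [set f k | k : 'I_(\rank M)].
have cardA : #|A| = (m - \rank M)%N.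
  by rewrite cardsCs setCK card_imset ?card_ord //; apply: maxrankfun_inj.
rewrite addn1 -cardA; apply: leq_trans (leqSpred _) _; rewrite ltnS.
pose w i := row i M *m P.
apply: (@leq_card_grid_cover F _ _ A w
  (fun i => b i 0 - (w i *m rowsub f b) 0 0)).
  move=> i _; apply: contraNneq (M0 i) => wi0.
  have /mulmxKpV <- : (row i M <= B)%MS.
    by rewrite (submx_trans (row_sub i M)) // eq_maxrowsub.
  by rewrite -/P -/(w i) wi0 mul0mx.
apply/subsetP => y; rewrite inE => /forallP y0.
have [i xi0] := cover (x y).
apply/bigcupP; exists i.
  rewrite inE; apply/imsetP => -[k _ ik]; case/eqP: (y0 k).
  have : (B *m x y + rowsub f b) k 0 = 0.
    rewrite mul_rowsub_mx mxE -[RHS]xi0 [RHS]mxE ik.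
    by congr (_ + _); rewrite mxE.
  by rewrite /x mulmxA BP mul1mx subrK.
have MxE : (M *m x y) i 0 = (w i *m y) 0 0 - (w i *m rowsub f b) 0 0.
  have -> : (M *m x y) i 0 = (w i *m (y - rowsub f b)) 0 0.
    by rewrite /w -mulmxA -row_mul [RHS]mxE.
  by rewrite mulmxBr mxE [X in _ + X]mxE.
by rewrite inE addrCA addrC -MxE; move: xi0; rewrite mxE => ->.
Qed.

Definition strategy_mx (n : nat) (e : rel 'I_n) (F : finFieldType)
    (a : 'M[F]_n) : 'M[F]_n :=
  (\matrix_(i, j) (if e i j then a i j else 0)) - 1%:M.

Lemma strategy_mx_fits (n : nat) (e : rel 'I_n) (F : finFieldType)
    (a : 'M[F]_n) :
  simple_graph e -> fits e (strategy_mx e a).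
Proof.
move=> [e_sym e_irr]; split=> [i | i j ij eij].
  by rewrite !mxE e_irr eqxx sub0r oppr_eq0 oner_neq0.
by rewrite !mxE (e_sym j i) (negbTE eij) (eq_sym j i) (negbTE ij) subr0.
Qed.

Lemma strategy_mxE (n : nat) (e : rel 'I_n) (F : finFieldType) (a : 'M[F]_n)
    (b x : 'rV[F]_n) (i : 'I_n) :
  (strategy_mx e a *m x^T + b^T) i 0 = guess e a b x i - x 0 i.
Proof.
rewrite /strategy_mx mulmxBl mul1mx !mxE /guess addrAC; congr (_ + _ - _).
rewrite [RHS]big_mkcond; apply: eq_bigr => j _; rewrite !mxE.
by case: ifP => // _; rewrite mul0r.
Qed.

Lemma mr_leq_rank (n : nat) (e : rel 'I_n) (F : finFieldType) (M : 'M[F]_n) :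
  fits e M -> (mr e <= \rank M)%N.
Proof.
move=> fitM; rewrite /mr; case: ex_minnP => r _; apply.
by apply/asboolP; exists F, M.
Qed.

Lemma lin_solvable_leq (n : nat) (e : rel 'I_n) (q : nat) :
  simple_graph e -> lin_solvable e q -> (q <= n - mr e + 1)%N.
Proof.
move=> he [F [<- [a [b win]]]].
have fitM := strategy_mx_fits a he.
apply: (@leq_trans (n - \rank (strategy_mx e a) + 1)%N); last first.
  by rewrite leq_add2r leq_sub2l // mr_leq_rank.
apply: (leq_card_cover (b := b^T)) => [i | x].
  by apply/rV0Pn; exists i; rewrite mxE; apply: fitM.1.
have [i xi] := win x^T; exists i.
by rewrite -[x]trmxK strategy_mxE xi subrr.
Qed.

Local Close Scope ring_scope.

Theorem theorem1p13 (n : nat) (e : rel 'I_n) (he : simple_graph e) :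
  (forall h : nat, is_HG_lin e h -> h <= n - mr e + 1) /\
  (forall q : nat, prime_power q -> lin_solvable e q -> q <= n - mr e + 1).
Proof.
split=> [h [_ solvable_h _] | q _ solvable_q]; exact: lin_solvable_leq.
Qed.
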